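(* For a digraph $G$, the following are equivalent: (i) $G$ is unbreakable, 3-cyclic and diwheel-free; (ii) $G$ is safely buildable.
   Context: A digraph is a finite directed graph without loops or parallel edges (directed cycles of length two are permitted); $uv$ denotes an edge from $u$ to $v$. A digraph is 3-cyclic if all its directed cycles have length three. For a digraph $G$, $G^-$ is the undirected simple graph with vertex set $V(G)$ in which distinct $u,v$ are adjacent if and only if $uv\in E(G)$ or $vu\in E(G)$. A non-null digraph is strongly connected if for every two vertices $u,v$ there is a directed path from $u$ to $v$; it is weakly 2-connected if $G^-$ is 2-connected (at least three vertices, connected, no cutvertex). $G$ is unbreakable if it is strongly connected and weakly 2-connected. A tricycle is a directed cycle of length three. A diwheel is a digraph obtained as follows: take an undirected graph consisting of a cycle $C$ of even length (at least four) and an extra vertex $v$ (the hub) adjacent to every vertex of $C$, and direct its edges so that for every edge of $C$, that edge together with $v$ forms a tricycle. $G$ is diwheel-free if no subdigraph of $G$ is a diwheel. A digraph $G$ is safely buildable if it can be constructed by starting with a tricycle and repeating (zero or more times) the following operation: given the current digraph $H$, choose a vertex $v$ of $H$ with degree 2 (so in-degree and out-degree both one); choose one of its neighbours $u$; and add a set of new vertices, each of degree two and making a tricycle with $u,v$ (that is, each new vertex $w$ is adjacent to or from exactly $u$ and $v$, and $\{u,v,w\}$ is the vertex set of a tricycle). *)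

(* Defs.v *)
From HB Require Import structures.
From mathcomp Require Import all_boot.

Set Implicit Arguments.
Unset Strict Implicit.
Unset Printing Implicit Defensive.

(* Vertices are drawn from an ambient finite type T, so that subdigraphs and
   the digraphs occurring in a construction all have type [digraph T].
   Edges being a set of ordered pairs, parallel edges are excluded, while
   directed cycles of length two are allowed. *)
Record digraph (T : finType) : Type := Digraph {
  vertices : {set T};
  edges : {set T * T};
  edges_sub : edges \subset setX vertices vertices;
  edges_loopless : [forall x, (x, x) \notin edges]
}.

Section DigraphDefs.

Variable T : finType.
Implicit Types (G H D : digraph T) (u v w x y z : T) (c : seq T).

Definition edge G : rel T := [rel u v | (u, v) \in edges G].

Definition subdigraph H G : Prop :=
  vertices H \subset vertices G /\ edges H \subset edges G.

Definition indegree G v : nat := #|[set u | edge G u v]|.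
Definition outdegree G v : nat := #|[set u | edge G v u]|.
Definition degree G v : nat := indegree G v + outdegree G v.

(* [ucycleb] holds of the empty sequence, hence the first conjunct. *)
Definition directed_cycle G c : bool := (c != [::]) && ucycleb (edge G) c.

Definition three_cyclic G : Prop :=
  forall c, directed_cycle G c -> size c = 3.

(* Adjacency in the undirected graph G^-. *)
Definition adj G : rel T := [rel u v | edge G u v || edge G v u].

Definition strongly_connected G : Prop :=
  vertices G != set0 /\ {in vertices G &, forall u v, connect (edge G) u v}.

(* Adjacency after deletion of v; in the ambient type v becomes isolated. *)
Definition adj_del G v : rel T :=
  [rel x y | [&& x != v, y != v & adj G x y]].

(* Deleting v separates two other vertices of the same component of G^-. *)
Definition cutvertex G v : Prop :=
  exists x y, [/\ x \in vertices G :\ v, y \in vertices G :\ v,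
                  connect (adj G) x y & ~~ connect (adj_del G v) x y].

Definition weakly_2connected G : Prop :=
  [/\ 3 <= #|vertices G|,
      {in vertices G &, forall u v, connect (adj G) u v}
    & {in vertices G, forall v, ~ cutvertex G v}].

Definition unbreakable G : Prop :=
  strongly_connected G /\ weakly_2connected G.

(* G itself is a tricycle. *)
Definition tricycle G : Prop :=
  exists x y z, [/\ uniq [:: x; y; z],
                    vertices G = [set x; y; z]
                  & edges G = [set (x, y); (y, z); (z, x)]].

(* {x, y, z} is the vertex set of a tricycle contained in G: up to rotation,
   a directed cycle on three vertices is given by one of two sequences. *)
Definition forms_tricycle G x y z : bool :=
  directed_cycle G [:: x; y; z] || directed_cycle G [:: x; z; y].

(* Adjacency in the undirected wheel with hub v and cycle c. *)
Definition wheel_adj v c : rel T :=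
  [rel x y | [|| (x == v) && (y \in c),
                 (y == v) && (x \in c)
               | [&& x \in c, y \in c & (y == next c x) || (x == next c y)]]].

(* The fourth and fifth conditions say that D is an orientation of the
   wheel: every edge of the wheel is directed in exactly one way. *)
Definition diwheel D : Prop :=
  exists v c,
    [/\ uniq (v :: c),
        (4 <= size c) && ~~ odd (size c) &
    [/\ vertices D = [set x in v :: c],
        forall x y, adj D x y = wheel_adj v c x y,
        forall x y, ~~ (edge D x y && edge D y x)
      & {in c, forall x, forms_tricycle D x (next c x) v}]].

Definition diwheel_free G : Prop :=
  forall D, subdigraph D G -> ~ diwheel D.

(* G arises from H by adding the set W of new vertices.  A new vertex w has
   two edges in its tricycle with u and v, so having degree two it is adjacent
   to no other vertex. *)
Definition safe_extension H G : Prop :=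
  exists u v (W : {set T}),
    [/\ v \in vertices H, degree H v = 2, adj H v u &
    [/\ [disjoint W & vertices H],
        vertices G = vertices H :|: W,
        {in vertices H &, forall x y, edge G x y = edge H x y}
      & {in W, forall w, degree G w = 2 /\ forms_tricycle G u v w}]].

Inductive safely_buildable : digraph T -> Prop :=
| safely_buildable_tricycle G : tricycle G -> safely_buildable G
| safely_buildable_extension H G :
    safely_buildable H -> safe_extension H G -> safely_buildable G.

End DigraphDefs.

(* Main.v *)
Require Import Defs.
From mathcomp Require Import all_boot.

Set Implicit Arguments.
Unset Strict Implicit.
Unset Printing Implicit Defensive.

(* If G is safely buildable, all the properties in (i) are preserved along the
   construction: a new cycle through a new vertex w must use the edge uv, since
   v had degree two, and a new vertex has degree two whereas every vertex of a
   diwheel has degree at least three.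

   Conversely let H be a maximal safely buildable subdigraph of G.  In H the
   link of every vertex (its neighbours, joined when they form a tricycle with
   it) is connected.  If an edge ab of G joined two vertices of H without lying
   in H, then every path of H from b to a would have length two, say
   b -> x -> a, and a path of the link of x from a to b together with ab would
   be the rim of a diwheel with hub x.  If H misses a vertex,
   2-connectivity gives a directed path of G leaving H at a and returning at
   b <> a; being closed up by a path of H from b to a into a tricycle, it is
   a -> w -> b, and the edge ba is the only path of H from b to a.  Then w can
   be added: if ba lies in two tricycles of H, w joins the operation that was
   applied to ba; otherwise a or b has degree two, as ba lies in a single
   tricycle abx and further tricycles on ax and on bx would provide a path of
   length four from b to a. *)

Section Digraphs.

Variable T : finType.
Implicit Types (G H D : digraph T) (u v w x y z : T) (c s : seq T).

Local Arguments edge : simpl never.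
Local Arguments adj : simpl never.

(** * Edges, tricycles and degrees *)

Lemma edge_vertices G x y :
  edge G x y -> x \in vertices G /\ y \in vertices G.
Proof.
by move=> exy; have /= := subsetP (edges_sub G) _ exy; rewrite inE => /andP[].
Qed.

Lemma edge_irr G x : edge G x x = false.
Proof. by apply/negbTE/(forallP (edges_loopless G) x). Qed.

Lemma edge_neq G x y : edge G x y -> x != y.
Proof. by apply: contraTneq => ->; rewrite edge_irr. Qed.

Lemma adj_sym G : symmetric (adj G).
Proof. by move=> x y; apply: orbC. Qed.

Lemma adj_neq G x y : adj G x y -> x != y.
Proof. by case/orP=> /edge_neq //; rewrite eq_sym. Qed.

Lemma adj_vertices G x y : adj G x y -> x \in vertices G /\ y \in vertices G.
Proof. by case/orP=> /edge_vertices []. Qed.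

Lemma forms_tricycleE G x y z :
  forms_tricycle G x y z =
  [&& edge G x y, edge G y z & edge G z x] ||
  [&& edge G x z, edge G z y & edge G y x].
Proof.
have E a b d : directed_cycle G [:: a; b; d] =
               [&& edge G a b, edge G b d & edge G d a].
  rewrite /directed_cycle /ucycleb /= !inE !andbT.
  apply: andb_idr => /and3P[/edge_neq ab /edge_neq bd /edge_neq da].
  by rewrite negb_or ab bd eq_sym da.
by rewrite /forms_tricycle !E.
Qed.

Lemma forms_tricycleC G x y z : forms_tricycle G x y z = forms_tricycle G y x z.
Proof.
rewrite !forms_tricycleE orbC; congr (_ || _); rewrite andbC -andbA //.
by rewrite [RHS]andbC andbA andbC andbA.
Qed.

Lemma forms_tricycle_rot G x y z :
  forms_tricycle G x y z = forms_tricycle G y z x.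
Proof.
rewrite !forms_tricycleE.
by do 6!case: (edge _ _ _).
Qed.

Lemma forms_tricycle_adj G x y z :
  forms_tricycle G x y z -> [/\ adj G x y, adj G y z & adj G z x].
Proof.
by rewrite forms_tricycleE => /orP[]/and3P[a b d];
  split; rewrite /adj /= ?a ?b ?d ?orbT.
Qed.

(** The neighbours are the union of the in- and out-neighbours, while [degree] counts a vertex
    joined in both directions twice; hence only an inequality. *)
Lemma leq_size_degree G v s :
  uniq s -> {in s, forall x, adj G v x} -> size s <= degree G v.
Proof.
move=> us sv; rewrite -(card_uniqP us) /degree /indegree /outdegree.
apply: leq_trans (leq_card_setU _ _); apply: subset_leq_card.
by apply/subsetP=> x /sv; rewrite !inE orbC.
Qed.

Lemma degree2_adj G u v w z :
  degree G w = 2 -> forms_tricycle G u v w -> adj G w z -> z \in [:: u; v].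
Proof.
move=> d2 /forms_tricycle_adj[uv vw wu] wz; apply: contraT; rewrite !inE => nz.
suff: size [:: z; u; v] <= 2 by [].
rewrite -d2; apply: leq_size_degree => [|x].
  by rewrite /= !inE nz (adj_neq uv).
by rewrite !inE => /or3P[]/eqP-> //; rewrite adj_sym.
Qed.

Lemma eq_degree G H x :
  (forall y, edge G x y = edge H x y) -> (forall y, edge G y x = edge H y x) ->
  degree G x = degree H x.
Proof.
move=> Ex Ey; rewrite /degree /indegree /outdegree.
by congr (_ + _); apply: eq_card => y; rewrite !inE.
Qed.

(** The edge from [v] to [x] uses up one unit of the degree, leaving room for a single edge into
    [v]. *)
Lemma degree2_unique_in G v x y z :
  degree G v = 2 -> edge G v x -> edge G y v -> edge G z v -> z = y.
Proof.
move=> d2 vx yv zv; apply/eqP; apply: contraT => zy.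
suff: 2 < 2 by [].
rewrite -{2}d2 /degree -[3]/(2 + 1); apply: leq_add.
  rewrite (_ : 2 = #|[set y; z]|); last by rewrite cards2 eq_sym zy.
  by apply/subset_leq_card/subsetP=> t; rewrite !inE => /orP[]/eqP->.
by apply/card_gt0P; exists x; rewrite inE.
Qed.

Lemma degree2_unique_out G v x y z :
  degree G v = 2 -> edge G x v -> edge G v y -> edge G v z -> z = y.
Proof.
move=> d2 vx yv zv; apply/eqP; apply: contraT => zy.
suff: 2 < 2 by [].
rewrite -{2}d2 /degree -[3]/(1 + 2); apply: leq_add.
  by apply/card_gt0P; exists x; rewrite inE.
rewrite (_ : 2 = #|[set y; z]|); last by rewrite cards2 eq_sym zy.
by apply/subset_leq_card/subsetP=> t; rewrite !inE => /orP[]/eqP->.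
Qed.

(** * Subdigraphs and 3-cyclic digraphs *)

Lemma edge_subdigraph G H : subdigraph H G -> subrel (edge H) (edge G).
Proof. by case=> _ /subsetP sE x y; apply: sE. Qed.

Lemma subdigraph_subrel G H :
  vertices H \subset vertices G -> subrel (edge H) (edge G) -> subdigraph H G.
Proof. by move=> sV sE; split=> //; apply/subsetP=> -[x y] /sE. Qed.

Lemma forms_tricycle_subdigraph G H x y z :
  subdigraph H G -> forms_tricycle H x y z -> forms_tricycle G x y z.
Proof.
move=> /edge_subdigraph sE; rewrite !forms_tricycleE.
by case/orP=> /and3P[/sE-> /sE-> /sE->]; rewrite ?orbT.
Qed.

Lemma three_cyclic_subdigraph G H :
  subdigraph H G -> three_cyclic G -> three_cyclic H.
Proof.
move=> /edge_subdigraph sE G3 c /andP[c0 /andP[cH uc]]; apply: G3.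
rewrite /directed_cycle c0 /ucycleb uc andbT.
by case: c cH {c0 uc} => //= x c; apply: sub_path.
Qed.

Lemma three_cyclic_size G x s :
  three_cyclic G -> path (edge G) x s -> edge G (last x s) x ->
  uniq (x :: s) -> size s = 2.
Proof.
move=> G3 xs sx us; apply: succn_inj; apply: (G3 (x :: s)).
by rewrite /directed_cycle /ucycleb us /= rcons_path xs sx.
Qed.

Lemma three_cyclic_asym G x y : three_cyclic G -> edge G x y -> ~~ edge G y x.
Proof.
move=> G3 xy; apply/negP=> yx.
have := @three_cyclic_size G x [:: y] G3; rewrite /= inE !andbT (edge_neq xy).
by rewrite -!/(edge _ _ _) => /(_ xy yx isT).
Qed.

(** A return path, once shortened, closes up with the edge [x y] to a directed cycle, which must
    have length three. *)
Lemma three_cyclic_arc G x y :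
  three_cyclic G -> edge G x y -> connect (edge G) y x ->
  exists z, edge G y z /\ edge G z x.
Proof.
move=> G3 xy /connectP[p yp ex].
move: xy; rewrite {}ex; case/shortenP: yp => {}p yp uyp _ xy.
have := three_cyclic_size G3 yp xy uyp.
by case: p yp {xy uyp} => [|z [|t []]] //= /and3P[yz zt _] _; exists z.
Qed.

(** Restricting to [V] and removing the diagonal makes both side conditions of the record hold for
    an arbitrary relation. *)
Definition digraph_edges (V : {set T}) (r : rel T) : {set T * T} :=
  [set p | [&& p.1 \in V, p.2 \in V, p.1 != p.2 & r p.1 p.2]].

Fact digraph_edges_sub (V : {set T}) (r : rel T) :
  digraph_edges V r \subset setX V V.
Proof. by apply/subsetP=> p; rewrite !inE => /and4P[-> ->]. Qed.

Fact digraph_edges_loopless (V : {set T}) (r : rel T) :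
  [forall x, (x, x) \notin digraph_edges V r].
Proof. by apply/forallP=> x; rewrite inE /= eqxx !andbF. Qed.

Definition mk_digraph (V : {set T}) (r : rel T) : digraph T :=
  Digraph (digraph_edges_sub V r) (digraph_edges_loopless V r).

Lemma edge_mk (V : {set T}) (r : rel T) x y :
  edge (mk_digraph V r) x y = [&& x \in V, y \in V, x != y & r x y].
Proof. by rewrite /edge /= inE. Qed.

Lemma subdigraph_mk (V : {set T}) (r : rel T) G :
  V \subset vertices G -> {in V &, subrel r (edge G)} ->
  subdigraph (mk_digraph V r) G.
Proof.
move=> sV sr; apply: subdigraph_subrel => // x y.
by rewrite edge_mk => /and4P[xV yV _ /sr]; apply.
Qed.

(** * Attaching new vertices *)

(** This is [safe_extension] freed from the demand that [v] have degree two. It is symmetric in [u]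
    and [v], and lets a vertex be attached to an edge before it is known how a safe construction
    produces the result. *)
Definition attached H G u v (W : {set T}) : Prop :=
  [/\ [disjoint W & vertices H],
      vertices G = vertices H :|: W,
      {in vertices H &, forall x y, edge G x y = edge H x y}
    & {in W, forall w, degree G w = 2 /\ forms_tricycle G u v w}].

Lemma safe_extensionP H G :
  safe_extension H G ->
  exists u v W, [/\ u \in vertices H, v \in vertices H, degree H v = 2,
                    adj H v u & attached H G u v W].
Proof.
case=> u [v [W [vH d2 vu att]]]; exists u, v, W.
by have [_ uH] := adj_vertices vu.
Qed.

Section Attached.

Variables (H G : digraph T) (u v : T) (W : {set T}).
Hypothesis att : attached H G u v W.

Lemma attached_subdigraph : subdigraph H G.
Proof.
have [_ VG EG _] := att; apply: subdigraph_subrel => [|x y xy].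
  by rewrite VG subsetUl.
by have [xH yH] := edge_vertices xy; rewrite EG.
Qed.

Lemma attached_notin w : w \in W -> w \notin vertices H.
Proof. by move=> wW; have [dis _ _ _] := att; rewrite (disjointFr dis wW). Qed.

Lemma attached_vertexP x : x \in vertices G -> x \in vertices H \/ x \in W.
Proof. by have [_ -> _ _] := att; rewrite inE => /orP. Qed.

Lemma attached_adj w z : w \in W -> adj G w z -> z \in [:: u; v].
Proof.
by move=> wW; have [_ _ _ /(_ w wW)[d2 tw]] := att; apply: degree2_adj.
Qed.

End Attached.

(** * Properties preserved by a safe extension *)

Lemma strongly_connected_extension H G :
  strongly_connected H -> safe_extension H G -> strongly_connected G.
Proof.
move=> [H0 Hc] /safe_extensionP[u [v [W [uH vH d2 vu att]]]].
have sHG := attached_subdigraph att.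
have HG : {in vertices H &, forall x y, connect (edge G) x y}.
  move=> x y xH yH; apply: connect_sub (Hc x y xH yH) => a b.
  by move/(edge_subdigraph sHG)/connect1.
split.
  by case/set0Pn: H0 => x xH; apply/set0Pn; exists x; apply: subsetP sHG.1 _ xH.
have W_H w : w \in W -> exists a b,
    [/\ a \in vertices H, b \in vertices H, edge G a w & edge G w b].
  have [_ _ _ tW] := att; move=> /tW[_]; rewrite forms_tricycleE.
  by case/orP=> /and3P[? ? ?]; [exists v, u|exists u, v].
have GH x : x \in vertices G -> exists a b,
    [/\ a \in vertices H, b \in vertices H, connect (edge G) a x
      & connect (edge G) x b].
  case/(attached_vertexP att) => [xH|/W_H[a [b [aH bH ax xb]]]].
    by exists x, x; split.
  by exists a, b; split=> //; apply: connect1.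
move=> x y /GH[_ [b [_ bH _ xb]]] /GH[a [_ [aH _ ay _]]].
exact: connect_trans xb (connect_trans (HG _ _ bH aH) ay).
Qed.

Lemma three_cyclic_extension H G :
  strongly_connected H -> three_cyclic H -> safe_extension H G ->
  three_cyclic G.
Proof.
move=> [_ Hc] H3 /safe_extensionP[u [v [W [uH vH d2 vu att]]]] c.
have sHG := attached_subdigraph att.
have [_ VG EG tW] := att.
case/and3P=> c0 cG uc.
(* A cycle with all its vertices in [H] is a cycle of [H]; any other is rotated so as to start at a
   new vertex [w]. *)
have [cH|/allPn[w wc wH]] := boolP (all (mem (vertices H)) c).
  apply: H3; rewrite /directed_cycle /ucycleb c0 uc andbT /=.
  apply: sub_in_cycle cH cG => x y xH yH.
  by rewrite EG.
have wW : w \in W.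
  have /edge_vertices[] := next_cycle cG wc.
  by move=> /(attached_vertexP att)[wH'|//]; case/negP: wH.
have [i p cp] := rot_to wc.
have -> : size c = (size p).+1 by rewrite -(size_rot i) cp.
have /andP[up cp'] : uniq (w :: p) && cycle (edge G) (w :: p).
  by rewrite -cp rot_uniq uc rot_cycle.
have [d2w tw] := tW w wW; rewrite forms_tricycleE in tw.
have lastK x q : uniq (x :: q) -> last x q = x -> q = [::].
  by case: q => //= y q /andP[xq _] lx; rewrite -lx mem_last in xq.
have uv : u != v by rewrite eq_sym (adj_neq vu).
have asym x y : x \in vertices H -> y \in vertices H -> edge G x y ->
    ~~ edge G y x.
  by move=> xH yH; rewrite !EG //; apply: three_cyclic_asym.
case/orP: tw => /and3P[g1 g2 g3].
- have /negbTE asym3 := asym _ _ uH vH g1.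
  (* Here [u -> v -> w -> u]. An old in-neighbour of [v] is [u] because [degree H v = 2]; the edge
     [u v] orients every new tricycle, so new vertices are only out-neighbours of [v]. *)
  have in_v z : edge G z v -> z = u.
    move=> zv; have [zG _] := edge_vertices zv.
    have [zH|zW] := attached_vertexP att zG.
      have [t [vt _]] : exists t, edge H v t /\ edge H t u.
        by apply: three_cyclic_arc H3 _ (Hc _ _ vH uH); rewrite -EG.
      by apply: degree2_unique_in d2 vt _ _; rewrite -EG.
    have [d2z] := tW z zW; rewrite forms_tricycleE.
    case/orP=> /and3P[h1 h2 h3]; last by rewrite asym3 in h3.
    by rewrite (degree2_unique_out d2z h2 h3 zv) eqxx in uv.
  case: p up cp' {cp} => [|y p] /=; first by rewrite edge_irr.
  move=> /andP[_ up] /andP[wy].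
  have yu := degree2_unique_out d2w g2 g3 wy.
  (* The cycle reads [w, u, ..., v]; since [v] is entered only from [u], nothing lies in between. *)
  case/lastP: p up => [_|q l]; rewrite {}yu /=.
    rewrite andbT => uw; by rewrite (degree2_unique_in d2w g3 g2 uw) eqxx in uv.
  rewrite mem_rcons rcons_uniq in_cons negb_or !rcons_path last_rcons.
  move=> /and3P[/andP[_ nu] _ uq] /andP[/andP[_ ql] lw].
  rewrite (degree2_unique_in d2w g3 g2 lw) in ql.
  by rewrite (lastK u q _ (in_v _ ql)) //= nu.
- have /negbTE asym3 := asym _ _ vH uH g3.
  (* Mirror case [u -> w -> v -> u]: now [v] is left only towards [u]. *)
  have out_v z : edge G v z -> z = u.
    move=> vz; have [_ zG] := edge_vertices vz.
    have [zH|zW] := attached_vertexP att zG.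
      have [t [_ tv]] : exists t, edge H u t /\ edge H t v.
        by apply: three_cyclic_arc H3 _ (Hc _ _ uH vH); rewrite -EG.
      by apply: degree2_unique_out d2 tv _ _; rewrite -EG.
    have [d2z] := tW z zW; rewrite forms_tricycleE.
    case/orP=> /and3P[h1 h2 h3]; first by rewrite asym3 in h1.
    by rewrite (degree2_unique_in d2z h2 h1 vz) eqxx in uv.
  case: p up cp' {cp} => [|y p] /=; first by rewrite edge_irr.
  move=> /andP[_ up] /andP[wy].
  have yv := degree2_unique_out d2w g1 g2 wy.
  case: p up => [_|z p]; rewrite {}yv /=.
    rewrite andbT => vw; by rewrite (degree2_unique_in d2w g2 g1 vw) eqxx in uv.
  move=> /andP[_ up] /andP[/out_v zu]; rewrite {}zu in up *.
  by rewrite rcons_path;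
    case/andP=> _ /(degree2_unique_in d2w g2 g1)/(lastK _ _ up)->.
Qed.

(** Adjacency in the link of [v]; closed walks of the link are the candidates for rims of diwheels
    with hub [v]. *)
Definition linked G v : rel T := fun x y => forms_tricycle G x y v.

Definition links_connected G : Prop :=
  forall v x y, adj G v x -> adj G v y -> connect (linked G v) x y.

Lemma linked_sym G v : symmetric (linked G v).
Proof. by move=> x y; apply: forms_tricycleC. Qed.

(** The link of a new vertex consists of the linked pair [u], [v]. The link of an old vertex can
    only gain new vertices, each tied to an old neighbour: to [v] in the link of [u], and to [u] in
    the link of [v]. *)
Lemma links_connected_extension H G :
  links_connected H -> safe_extension H G -> links_connected G.
Proof.
move=> HL /safe_extensionP[u [v [W [uH vH d2 vu att]]]] t x y tx ty.
have sHG := attached_subdigraph att.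
have [_ VG EG tW] := att.
have csym := sym_connect_sym (linked_sym G t).
have [tH|tW'] := attached_vertexP att (adj_vertices tx).1; last first.
  have [_ uvt] := tW t tW'.
  have uv : linked G t u v by [].
  have := attached_adj att tW' tx; have := attached_adj att tW' ty.
  rewrite !inE => /orP[]/eqP-> /orP[]/eqP-> //; first by rewrite csym connect1.
  exact: connect1.
have toH z : adj G t z -> exists2 z', adj H t z' & connect (linked G t) z z'.
  move=> tz; have [zH|zW] := attached_vertexP att (adj_vertices tz).2.
    by exists z => //; move: tz; rewrite /adj /= !EG.
  have [_ tz'] := tW z zW.
  have: t \in [:: u; v] by apply: (attached_adj att zW); rewrite adj_sym.
  rewrite !inE => /orP[]/eqP->; [exists v; rewrite 1?adj_sym //|exists u => //].
    by apply/connect1; rewrite /linked forms_tricycleC -forms_tricycle_rot.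
  by apply/connect1; rewrite /linked forms_tricycle_rot.
have [x' tx' cx] := toH x tx; have [y' ty' cy] := toH y ty.
apply: connect_trans cx _; rewrite csym; apply: connect_trans cy _.
apply: connect_sub (HL t y' x' ty' tx') => a b ab.
exact/connect1/(forms_tricycle_subdigraph sHG).
Qed.

(** Absence of cutvertices in a form suited to induction: the two vertices are not assumed to be
    connected beforehand. *)
Definition vertex_deleted_connected G : Prop :=
  {in vertices G, forall v, {in vertices G :\ v &, forall x y,
     connect (adj_del G v) x y}}.

Lemma adj_del_sym G v : symmetric (adj_del G v).
Proof. by move=> x y; rewrite /adj_del /= adj_sym andbCA. Qed.

Lemma strongly_connected_adj G :
  strongly_connected G -> {in vertices G &, forall x y, connect (adj G) x y}.
Proof.
move=> [_ Gc] x y xG yG; apply: connect_sub (Gc x y xG yG) => a b ab.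
by apply: connect1; rewrite /adj /= ab.
Qed.

Lemma weakly_2connectedI G :
  3 <= #|vertices G| -> strongly_connected G -> vertex_deleted_connected G ->
  weakly_2connected G.
Proof.
move=> G3 Gs Gd; split=> //; first exact: strongly_connected_adj.
by move=> v vG [x [y [xG yG _]]] /negP; apply; apply: Gd.
Qed.

(** A new vertex has both [u] and [v] as neighbours, and deleting [t] spares at least one of them.
    If [t] is itself new, its deletion leaves [H] intact. *)
Lemma vertex_deleted_connected_extension H G :
  strongly_connected H -> vertex_deleted_connected H -> safe_extension H G ->
  vertex_deleted_connected G.
Proof.
move=> /strongly_connected_adj Hs Hd.
move=> /safe_extensionP[u [v [W [uH vH d2 vu att]]]] t tG.
have sHG := attached_subdigraph att.
have [_ VG EG tW] := att.
have csym := sym_connect_sym (adj_del_sym G t).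
have sadj a b : adj H a b -> adj G a b.
  by case/orP=> /(edge_subdigraph sHG) ab; rewrite /adj /= ab ?orbT.
have toH x : x \in vertices G :\ t ->
    exists2 s, s \in vertices H :\ t & connect (adj_del G t) x s.
  rewrite inE in_set1 => /andP[xt /(attached_vertexP att)[xH|xW]].
    by exists x => //; rewrite !inE xt.
  have [_ /forms_tricycle_adj[_ vx xu]] := tW x xW.
  rewrite adj_sym in vx.
  have [ut|ut] := eqVneq u t; last first.
    by exists u; rewrite ?inE ?ut //;
    apply: connect1; rewrite /adj_del /= xt ut.
  have vt : v != t by rewrite -ut (adj_neq vu).
  by exists v; rewrite ?inE ?vt //; apply: connect1; rewrite /adj_del /= xt vt.
have HH : {in vertices H :\ t &, forall x y, connect (adj_del G t) x y}.
  have [tH|tW'] := attached_vertexP att tG.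
    move=> x y xH yH; apply: connect_sub (Hd t tH x y xH yH) => a b.
    case/and3P=> at' bt /sadj ab.
    by apply: connect1; rewrite /adj_del /= at' bt.
  move=> x y /setD1P[_ xH] /setD1P[_ yH].
  apply: connect_sub (Hs x y xH yH) => a b ab; have [aH bH] := adj_vertices ab.
  have nt z : z \in vertices H -> z != t.
    by apply: contraTneq => ->; apply: attached_notin att _ tW'.
  by apply: connect1; rewrite /adj_del /= !nt // sadj.
move=> x y /toH[x' x'H cx] /toH[y' y'H cy].
apply: connect_trans cx _; rewrite csym; apply: connect_trans cy _.
exact: HH.
Qed.

(** Needed to tell the two rim neighbours of a rim vertex apart. *)
Lemma next_next_neq c x :
  uniq c -> 2 < size c -> x \in c -> next c (next c x) != x.
Proof.
move=> uc c3 xc; have [i p cp] := rot_to xc.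
rewrite -!(next_rot i uc) cp; have := uc; rewrite -(rot_uniq i) cp.
have: 2 < size (x :: p) by rewrite -cp size_rot.
case: p {cp} => [|y [|z p]] //= _; rewrite !inE !negb_or.
case/and3P=> /and3P[]; rewrite eq_sym => /negbTE yx xz _ _ _.
by rewrite eqxx yx eqxx eq_sym.
Qed.

(** The hub sees the whole rim, and a rim vertex sees the hub and its two rim neighbours. *)
Lemma diwheel_degree D x : diwheel D -> x \in vertices D -> 2 < degree D x.
Proof.
case=> v [c [/andP[vc uc] /andP[c4 _] [-> DA _ _]]].
rewrite !inE => /predU1P[->|xc].
  apply: leq_trans (leq_size_degree uc _); first exact: ltnW.
  by move=> y yc; rewrite DA /wheel_adj /= eqxx yc.
suff: size [:: v; next c x; prev c x] <= degree D x by [].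
apply: leq_size_degree.
  rewrite /= !inE negb_or !andbT -andbA; apply/and3P; split.
  - by apply: contraNneq vc => ->; rewrite mem_next.
  - by apply: contraNneq vc => ->; rewrite mem_prev.
  apply: contraNneq (next_next_neq uc (ltnW c4) xc) => ->.
  by rewrite next_prev.
move=> y; rewrite !inE DA /wheel_adj /= xc.
case/or3P=> /eqP->; rewrite ?eqxx ?orbT //.
  by rewrite mem_next xc ?orbT.
by rewrite mem_prev xc next_prev ?eqxx ?orbT.
Qed.

Lemma leq_degree_subdigraph G H x : subdigraph H G -> degree H x <= degree G x.
Proof.
move=> /edge_subdigraph sE; apply: leq_add; apply/subset_leq_card/subsetP=> y;
  by rewrite !inE => /sE.
Qed.

Lemma diwheel_free_extension H G :
  diwheel_free H -> safe_extension H G -> diwheel_free G.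
Proof.
move=> HD /safe_extensionP[u [v [W [uH vH d2 vu att]]]] D sDG wD.
have [_ VG EG tW] := att.
have sVH : vertices D \subset vertices H.
  apply/subsetP=> x xD.
  have [//|/tW[d2x _]] := attached_vertexP att (subsetP sDG.1 x xD).
  by have := leq_trans (diwheel_degree wD xD) (leq_degree_subdigraph x sDG);
     rewrite d2x.
apply: HD wD; apply: subdigraph_subrel => // x y xy.
have [xD yD] := edge_vertices xy.
by rewrite -EG ?(subsetP sVH) //; apply: edge_subdigraph sDG _ _ xy.
Qed.

(** * The base case: a single tricycle *)

Lemma tricycleP G : tricycle G ->
  exists x y z, [/\ uniq [:: x; y; z], vertices G =i [:: x; y; z]
    & forall a b, edge G a b = ((a, b) \in [:: (x, y); (y, z); (z, x)])].
Proof.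
case=> x [y [z [u3 VG EG]]]; exists x, y, z; split=> // [a|a b].
  by rewrite VG !inE orbA.
by rewrite /edge /= EG !inE orbA.
Qed.

Lemma tricycle_size G s :
  tricycle G -> uniq s -> {subset s <= vertices G} -> size s <= 3.
Proof.
move=> /tricycleP[x [y [z [_ VG _]]]] us sV.
by apply: (uniq_leq_size (s2 := [:: x; y; z])) => // t /sV; rewrite VG.
Qed.

Lemma tricycle_forms G a b d :
  tricycle G -> uniq [:: a; b; d] -> {subset [:: a; b; d] <= vertices G} ->
  forms_tricycle G a b d.
Proof.
move=> /tricycleP[x [y [z [_ VG EG]]]] us sV.
have /sV := mem_head a [:: b; d].
have /sV : b \in [:: a; b; d] by rewrite !inE eqxx orbT.
have /sV : d \in [:: a; b; d] by rewrite !inE eqxx !orbT.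
move: us; rewrite !VG forms_tricycleE !EG /= !inE !xpair_eqE !andbT.
(* Of the 27 placements of [a], [b], [d], the non-injective ones contradict [us']. *)
move=> us' /or3P[] /eqP ? /or3P[] /eqP ? /or3P[] /eqP ?; subst a b d;
by move: us'; rewrite ?eqxx /= ?orbT ?andbF.
Qed.

Lemma three_cyclic_tricycle G : tricycle G -> three_cyclic G.
Proof.
move=> tG [|a [|b [|d [|e c]]]] //; rewrite /directed_cycle /ucycleb /=.
- by rewrite edge_irr.
- have [x [y [z [u3 _ EG]]]] := tricycleP tG.
  move: u3; rewrite /= !inE !andbT negb_or => /andP[/andP[]].
  move=> /negbTE xy /negbTE xz /negbTE yz.
  rewrite !EG !inE !xpair_eqE => /andP[/andP[ab ba] _].
  by case/or3P: ab => /andP[/eqP ? /eqP ?]; subst a b; move: ba;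
    rewrite ?(eq_sym y x) ?(eq_sym z x) ?(eq_sym z y) xy xz yz ?andbF.
- rewrite -[X in X && _]/(cycle (edge G) [:: a, b, d, e & c]).
  rewrite -[X in _ && X]/(uniq [:: a, b, d, e & c]) => /andP[cG uc].
  have := tricycle_size tG uc.
  suff cV: {subset [:: a, b, d, e & c] <= vertices G} by move/(_ cV).
  by move=> x /(next_cycle cG)/edge_vertices[].
Qed.

Lemma strongly_connected_tricycle G : tricycle G -> strongly_connected G.
Proof.
move=> /tricycleP[x [y [z [_ VG EG]]]]; split.
  by apply/set0Pn; exists x; rewrite VG mem_head.
move=> a b; rewrite !VG; apply: connect_cycle.
by rewrite /= !EG !inE !eqxx !orbT.
Qed.

Lemma links_connected_tricycle G : tricycle G -> links_connected G.
Proof.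
move=> tG v x y vx vy; have [->//|xy] := eqVneq x y.
apply/connect1/tricycle_forms=> //.
  by rewrite /= !inE negb_or xy !(eq_sym _ v) (adj_neq vx) (adj_neq vy).
have [vG xG] := adj_vertices vx; have [_ yG] := adj_vertices vy.
by move=> z; rewrite !inE => /or3P[]/eqP->.
Qed.

Lemma vertex_deleted_connected_tricycle G :
  tricycle G -> vertex_deleted_connected G.
Proof.
move=> tG v vG x y /setD1P[xv xG] /setD1P[yv yG].
have [->//|xy] := eqVneq x y.
have /forms_tricycle_adj[xy' _ _]: forms_tricycle G x y v.
  apply: tricycle_forms; rewrite //= ?inE ?negb_or ?xy ?xv ?yv //.
  by move=> z; rewrite !inE => /or3P[]/eqP->.
by apply: connect1; rewrite /adj_del /= xv yv.
Qed.

Lemma diwheel_free_tricycle G : tricycle G -> diwheel_free G.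
Proof.
move=> tG D sDG [v [c [uc /andP[c4 _] [VD _ _ _]]]].
suff: size (v :: c) <= 3 by rewrite /= ltnS leqNgt ltnW.
apply: tricycle_size tG uc _ => x xc; apply: (subsetP sDG.1).
by rewrite VD inE.
Qed.

Lemma card_tricycle G : tricycle G -> #|vertices G| = 3.
Proof.
by case/tricycleP=> x [y [z [u3 VG _]]]; rewrite (eq_card VG); apply/card_uniqP.
Qed.

(** * Properties of safely buildable digraphs *)

Lemma safely_buildable_strongly_connected G :
  safely_buildable G -> strongly_connected G.
Proof.
elim=> [H /strongly_connected_tricycle //|H K _].
exact: strongly_connected_extension.
Qed.

Lemma safely_buildable_three_cyclic G : safely_buildable G -> three_cyclic G.
Proof.
elim=> [H /three_cyclic_tricycle //|H K sbH].
exact/three_cyclic_extension/safely_buildable_strongly_connected.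
Qed.

Lemma safely_buildable_links_connected G :
  safely_buildable G -> links_connected G.
Proof.
elim=> [H /links_connected_tricycle //|H K _]; exact: links_connected_extension.
Qed.

Lemma safely_buildable_diwheel_free G : safely_buildable G -> diwheel_free G.
Proof.
elim=> [H /diwheel_free_tricycle //|H K _]; exact: diwheel_free_extension.
Qed.

Lemma safely_buildable_unbreakable G : safely_buildable G -> unbreakable G.
Proof.
move=> sbG; have sG := safely_buildable_strongly_connected sbG.
split=> //; apply: weakly_2connectedI => //; elim: sbG {sG} => [H tH|H K sbH].
- by rewrite card_tricycle.
- move=> IH /safe_extensionP[u [v [W [_ _ _ _ att]]]].
  exact/(leq_trans IH)/subset_leq_card/(attached_subdigraph att).1.
- exact: vertex_deleted_connected_tricycle.
- move=> IH; apply: vertex_deleted_connected_extension IH.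
  exact: safely_buildable_strongly_connected.
Qed.

(** * Attaching one vertex to a safely buildable digraph *)

Lemma eq_forms_tricycle (V : {set T}) G H x y z :
  {in V &, forall x y, edge G x y = edge H x y} ->
  x \in V -> y \in V -> z \in V ->
  forms_tricycle G x y z = forms_tricycle H x y z.
Proof. by move=> E xV yV zV; rewrite !forms_tricycleE !E. Qed.

Lemma edge_mk_in (V : {set T}) G :
  {in V &, forall x y, edge (mk_digraph V (edge G)) x y = edge G x y}.
Proof.
move=> x y xV yV; by rewrite edge_mk xV yV /= andb_idl //; apply: edge_neq.
Qed.

Lemma attached_sym H G u v W : attached H G u v W -> attached H G v u W.
Proof.
case=> dis VG EG tW; split=> // w /tW[d2 tw].
by rewrite forms_tricycleC.
Qed.

Lemma edge_nonadj G x y :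
  ~~ adj G x y -> (edge G x y = false) * (edge G y x = false).
Proof. by rewrite /adj /= negb_or => /andP[/negbTE-> /negbTE->]. Qed.

Lemma attached_degree H G u v W x :
  attached H G u v W -> x \in vertices H -> x \notin [:: u; v] ->
  degree G x = degree H x.
Proof.
move=> att xH nx; have [_ VG EG _] := att.
have nG y : y \notin vertices H -> ~~ adj G x y.
  move=> yH; apply: contra nx => xy.
  have [yH'|yW] := attached_vertexP att (adj_vertices xy).2.
    by rewrite yH' in yH.
  by apply: (attached_adj att yW); rewrite adj_sym.
have nH y : y \notin vertices H -> ~~ adj H x y.
  by apply: contra => /adj_vertices[].
by apply: eq_degree => y; have [yH|yH] := boolP (y \in vertices H);
  rewrite ?(edge_nonadj (nG y yH)) ?(edge_nonadj (nH y yH)) // EG.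
Qed.

Lemma two_tricycles_degree G a b z1 z2 :
  forms_tricycle G a b z1 -> forms_tricycle G a b z2 -> z1 != z2 ->
  2 < degree G a.
Proof.
move=> /forms_tricycle_adj[ab bz1 z1a] /forms_tricycle_adj[_ bz2 z2a] z12.
suff: size [:: b; z1; z2] <= degree G a by [].
apply: leq_size_degree.
  by rewrite /= !inE negb_or z12 (adj_neq bz1) (adj_neq bz2).
by move=> x; rewrite !inE => /or3P[]/eqP-> //; rewrite adj_sym.
Qed.

(* A further tricycle on an edge that already lies in two of them can be moved
   back to the operation that made the edge lie in two tricycles. *)
Lemma safely_buildable_attach_thick H G a b w z1 z2 :
  safely_buildable H -> forms_tricycle H a b z1 -> forms_tricycle H a b z2 ->
  z1 != z2 -> attached H G a b [set w] -> safely_buildable G.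
Proof.
move=> sbH; elim: sbH G => {H} [H tH|K H sbK IH extH] G t1 t2 z12 attG.
  (* A single tricycle has no room for the four distinct vertices [a], [b], [z1], [z2]. *)
  have d3 := two_tricycles_degree t1 t2 z12.
  have [ab bz1 z1a] := forms_tricycle_adj t1.
  have [_ bz2 z2a] := forms_tricycle_adj t2.
  suff: size [:: a; b; z1; z2] <= 3 by [].
  apply: tricycle_size tH _ _.
    rewrite /= !inE !negb_or z12 (adj_neq ab) (adj_neq bz1) (adj_neq bz2).
    by rewrite !(eq_sym a) (adj_neq z1a) (adj_neq z2a).
  have [aH bH] := adj_vertices ab; have [z1H _] := adj_vertices z1a.
  have [z2H _] := adj_vertices z2a.
  by move=> x; rewrite !inE => /or4P[]/eqP->.
have [u [v [W [uK vK d2 vu attH]]]] := safe_extensionP extH.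
have sKH := attached_subdigraph attH; have sHG := attached_subdigraph attG.
have [disH VH EH tH] := attH; have [disG VG EG tG] := attG.
have wH : w \notin vertices H by apply: (attached_notin attG); rewrite set11.
have wK : w \notin vertices K by apply: contra wH; apply: (subsetP sKH.1).
have [ab bz1 z1a] := forms_tricycle_adj t1.
have [_ bz2 z2a] := forms_tricycle_adj t2.
have degG w' : w' \in W -> a \in vertices K -> b \in vertices K ->
    degree G w' = 2 /\ forms_tricycle G u v w'.
  move=> w'W aK bK; have [d2w tw] := tH w' w'W.
  split; last exact: forms_tricycle_subdigraph sHG tw.
  have w'K := attached_notin attH w'W.
  rewrite (attached_degree attG) ?d2w // ?VH ?inE ?w'W ?orbT //.
  by apply/norP; split; apply: contraNneq w'K => ->.
(* If [a], [b] are the ends [u], [v] used by the last operation, [w] simply joins [W]. Otherwise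
   both tricycles already lie in [K]: there [w] is attached by induction, and the last operation is
   performed afterwards. *)
have [/andP[auv buv]|nuv] := boolP ((a \in [:: u; v]) && (b \in [:: u; v])).
  have uvK x : x \in [:: u; v] -> x \in vertices K.
    by rewrite !inE => /orP[]/eqP->.
  apply: safely_buildable_extension sbK _; exists u, v, (w |: W); split=> //.
  split.
  - rewrite disjoints_subset; apply/subsetP=> x; rewrite !inE.
    by case/predU1P=> [->|/(attached_notin attH)].
  - by rewrite VG VH setUC setUCA.
  - move=> x y xK yK; rewrite EG ?EH //; exact: (subsetP sKH.1).
  - move=> x; rewrite !inE => /predU1P[->|xW]; last first.
      by apply: degG => //; apply: uvK.
    have [d2w tw] := tG w (set11 w); split=> //.
    move: auv buv (adj_neq ab) tw; rewrite !inE.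
    by case/orP=> /eqP-> /orP[]/eqP->; rewrite ?eqxx //= => _;
      rewrite forms_tricycleC.
have inK x : x \notin W -> x \in vertices H -> x \in vertices K.
  by move=> xW /(attached_vertexP attH)[//|xW']; rewrite xW' in xW.
have aK : a \in vertices K.
  apply: inK => //; last exact: (adj_vertices ab).1.
  apply/negP=> /tH[d2a _]; have := two_tricycles_degree t1 t2 z12.
  by rewrite d2a.
have bK : b \in vertices K.
  apply: inK => //; last exact: (adj_vertices ab).2.
  apply/negP=> /tH[d2b _]; move: t1 t2; rewrite !(forms_tricycleC _ a) => t1 t2.
  by have := two_tricycles_degree t1 t2 z12; rewrite d2b.
have zK z : forms_tricycle H a b z -> z \in vertices K.
  move=> /forms_tricycle_adj[_ bz za]; apply: inK => //.
    apply: contra nuv => zW; rewrite adj_sym in bz.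
    by rewrite !(attached_adj attH zW).
  exact: (adj_vertices za).1.
have tK z : forms_tricycle H a b z -> forms_tricycle K a b z.
  by move=> tz; rewrite -(eq_forms_tricycle EH) //; apply: zK.
have EGK : {in vertices K &, forall x y, edge G x y = edge K x y}.
  by move=> x y xK yK; rewrite EG ?EH //; apply: (subsetP sKH.1).
(* [G'] is [K] with [w] attached, that is, [G] without the vertices of [W]. *)
pose V := w |: vertices K; pose G' := mk_digraph V (edge G).
have KV x : x \in vertices K -> x \in V by move=> xK; rewrite !inE xK orbT.
have wV : w \in V by rewrite setU11.
have EG' := @edge_mk_in V G.
have [d2w tw] := tG w (set11 w).
have attG' : attached K G' a b [set w].
  split.
  - by rewrite disjoints1.
  - exact: setUC.
  - by move=> x y xK yK; rewrite EG' ?EGK //; apply: KV.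
  - move=> x; rewrite in_set1 => /eqP->.
    split; last by rewrite (eq_forms_tricycle EG') //; apply: KV.
    rewrite -d2w; have abV y : adj G w y -> y \in V.
      move/(attached_adj attG (set11 w)); rewrite !inE.
      by case/orP=> /eqP->; rewrite ?aK ?bK orbT.
    apply: eq_degree => y; have [yV|yV] := boolP (y \in V);
      [by rewrite EG'| |by rewrite EG'|];
      rewrite edge_mk (negbTE yV) ?andbF //; apply/esym/negbTE;
      by apply: contra yV => wy; apply: abV; rewrite /adj /= wy ?orbT.
have sbG' := IH G' (tK _ t1) (tK _ t2) z12 attG'.
apply: safely_buildable_extension sbG' _; exists u, v, W.
have sKG' := attached_subdigraph attG'.
(* In [K] both [a] and [b] have degree above two, unlike [v]. So [w] is not attached to [v], which
   keeps degree two in [G']. *)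
have vab : v \notin [:: a; b].
  rewrite !inE; apply/norP; split; apply: contra_eqN d2 => /eqP->.
    by rewrite neq_ltn (two_tricycles_degree (tK _ t1) (tK _ t2) z12) orbT.
  move: t1 t2 => /tK + /tK; rewrite !(forms_tricycleC _ a) => t1 t2.
  by rewrite neq_ltn (two_tricycles_degree t1 t2 z12) orbT.
split; [exact: KV| by rewrite (attached_degree attG')| |].
  by case/orP: vu => /(edge_subdigraph sKG') e; rewrite /adj /= e ?orbT.
split=> [|||w' w'W]; last exact: degG.
- rewrite disjoints_subset; apply/subsetP=> x xW; rewrite !inE negb_or.
  rewrite (attached_notin attH xW) andbT.
  by apply: contraNneq wH => <-; rewrite VH inE xW orbT.
- by rewrite VG VH /= /V setUC setUA.
- by move=> x y xV yV; rewrite EG'.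
Qed.

(** In the link of [a], the vertices [b] and [x] have no neighbours but each other. The link being
    connected, they are all the neighbours of [a]. *)
Lemma degree2_of_single_tricycles G a b x :
  three_cyclic G -> links_connected G -> forms_tricycle G a b x ->
  (forall z, forms_tricycle G a b z -> z = x) ->
  (forall z, forms_tricycle G a x z -> z = b) -> degree G a = 2.
Proof.
move=> G3 GL tabx Ub Ux; have [ab bx xa] := forms_tricycle_adj tabx.
have nbr y : adj G a y = (y \in [set b; x]).
  apply/idP/idP=> [ay|]; last first.
    by rewrite !inE => /orP[]/eqP-> //; rewrite adj_sym.
  have /connectP[p] := GL a b y ab ay.
  have: b \in [set b; x] by rewrite set21.
  elim: p {1 3 4}b => [|t p IHp] s /= tbx; first by move=> _ ->.
  case/andP=> ty; apply: IHp; move: tbx ty.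
  rewrite /linked -forms_tricycle_rot !inE.
  by case/orP=> /eqP-> => [/Ub|/Ux] ->; rewrite eqxx ?orbT.
(* Without directed cycles of length two, in- and out-neighbours are disjoint, so the degree is the
   size of their union. *)
rewrite /degree /indegree /outdegree -cardsUI.
rewrite (_ : _ :|: _ = [set b; x]); last first.
  by apply/setP=> y; rewrite -nbr !inE orbC.
rewrite (_ : _ :&: _ = set0) ?cards0 ?cards2 ?(adj_neq bx) //.
apply/setP=> y; rewrite !inE; apply/negbTE/negP=> /andP[ya].
by apply/negP; apply: three_cyclic_asym.
Qed.

Lemma safely_buildable_attach_degree2 H G u v W :
  safely_buildable H -> adj H v u -> degree H v = 2 -> attached H G u v W ->
  safely_buildable G.
Proof.
move=> sbH vu d2 att; apply: safely_buildable_extension sbH _.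
by exists u, v, W; have [vH _] := adj_vertices vu; split.
Qed.

Lemma safely_buildable_attach_ear H G a b w :
  safely_buildable H -> edge H b a ->
  (forall p, path (edge H) b p -> last b p = a -> uniq (b :: p) ->
     size p = 1) ->
  attached H G a b [set w] -> safely_buildable G.
Proof.
move=> sbH ba short att.
have H3 := safely_buildable_three_cyclic sbH.
have HL := safely_buildable_links_connected sbH.
have [_ Hc] := safely_buildable_strongly_connected sbH.
have [bH aH] := edge_vertices ba.
have [x [ax xb]] := three_cyclic_arc H3 ba (Hc a b aH bH).
have tabx : forms_tricycle H a b x by rewrite forms_tricycleE ax xb ba orbT.
have ab : adj H a b by case/forms_tricycle_adj: tabx.
have tba : forms_tricycle H b a x by rewrite forms_tricycleC.
have [/existsP[z /andP[zx tz]]|/existsPn Uab] :=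
  boolP [exists z, (z != x) && forms_tricycle H a b z].
  exact: safely_buildable_attach_thick sbH tz tabx zx att.
have {}Uab z : forms_tricycle H a b z -> z = x.
  by move=> tz; apply/eqP; have := Uab z; rewrite tz andbT negbK.
have [/existsP[y /andP[yb ty]]|/existsPn Uax] :=
  boolP [exists z, (z != b) && forms_tricycle H a x z]; last first.
  apply: (safely_buildable_attach_degree2 sbH _ _ (attached_sym att)) => //.
  apply: degree2_of_single_tricycles H3 HL tabx Uab _ => z tz.
  by apply/eqP; have := Uax z; rewrite tz andbT negbK.
have [/existsP[z /andP[za tz]]|/existsPn Ubx] :=
  boolP [exists z, (z != a) && forms_tricycle H b x z]; last first.
  apply: (safely_buildable_attach_degree2 sbH _ _ att).
    by rewrite adj_sym.
  apply: (degree2_of_single_tricycles H3 HL tba) => z tz.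
    by apply: Uab; rewrite forms_tricycleC.
  by apply/eqP; have := Ubx z; rewrite tz andbT negbK.
have asym p q : edge H p q -> edge H q p = false.
  by move=> pq; apply/negbTE/three_cyclic_asym.
(* The orientations are forced to be [x -> y -> a] and [b -> z -> x], so [b, z, x, y, a] is a path
   of length four, against [short]. *)
move: ty tz; rewrite !forms_tricycleE.
rewrite (asym _ _ ax) (asym _ _ xb) !andbF orbF /=.
case/and3P=> _ xy ya /and3P[bz zx _].
have zy : z != y by apply: contraTneq zx => ->; rewrite asym.
have := short [:: z; x; y; a]; rewrite /= bz zx xy ya !inE !negb_or.
rewrite (edge_neq bz) (edge_neq ba) (eq_sym b x) (edge_neq xb) (eq_sym b y) yb.
rewrite (edge_neq zx) zy za (edge_neq xy) (eq_sym x a) (edge_neq ax).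
by rewrite (edge_neq ya) => /(_ isT erefl isT).
Qed.

(** The list of edges in the conclusion serves to show that the enlarged digraph is a subdigraph of
    any digraph that contains [H] and the path [a -> w -> b]. *)
Lemma exists_attached_ear H a b w :
  edge H b a -> w \notin vertices H ->
  exists G, [/\ attached H G a b [set w], vertices G = w |: vertices H
    & forall x y, edge G x y ->
        [\/ edge H x y, (x, y) = (a, w) | (x, y) = (w, b)]].
Proof.
move=> ba wH; have [bH aH] := edge_vertices ba.
pose r := [rel x y | [|| edge H x y, (x, y) == (a, w) | (x, y) == (w, b)]].
have nw x : x \in vertices H -> (x == w = false) * (w == x = false).
  move=> xH; rewrite eq_sym; suff: w != x by move/negbTE->.
  by apply: contraNneq wH => ->.
have wF x : (edge H w x = false) * (edge H x w = false).
  by split; apply/negbTE; apply: contra wH => /edge_vertices[].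
pose G := mk_digraph (w |: vertices H) r; exists G.
have EG x y : edge G x y = r x y.
  rewrite edge_mk !andbA andb_idl // => /or3P[xy|/eqP[-> ->]|/eqP[-> ->]].
  - have [xH yH] := edge_vertices xy.
    by rewrite !inE xH yH !orbT (edge_neq xy).
  - by rewrite !inE aH eqxx orbT /= nw.
  - by rewrite !inE bH eqxx orbT /= nw.
split=> //; last first.
  move=> x y; rewrite EG => /or3P[xy|/eqP xy|/eqP xy];
  [exact: Or31|exact: Or32|exact: Or33].
split.
- by rewrite disjoints1.
- exact: setUC.
- by move=> x y xH yH; rewrite EG /= !xpair_eqE !nw ?andbF ?orbF.
- move=> x; rewrite in_set1 => /eqP->; split; last first.
    by rewrite forms_tricycleE !EG /= ba !eqxx !orbT.
  rewrite /degree /indegree /outdegree.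
  rewrite (_ : [set _ | _] = [set a]); last first.
    by apply/setP=> y; rewrite !inE EG /= wF !xpair_eqE (nw b) //;
      rewrite eqxx !andbT andbF orbF.
  rewrite (_ : [set _ | _] = [set b]) ?cards1 //.
  by apply/setP=> y; rewrite !inE EG /= wF !xpair_eqE (nw a) // eqxx.
Qed.

(** * A missing chord yields a diwheel *)

Lemma chord_diwheel H G a b :
  three_cyclic G -> subdigraph H G -> strongly_connected H ->
  links_connected H -> a \in vertices H -> b \in vertices H ->
  edge G a b -> ~~ edge H a b -> ~ diwheel_free G.
Proof.
move=> G3 sHG [_ Hc] HL aH bH gab hab Gfree.
have sE := edge_subdigraph sHG.
have H3 := three_cyclic_subdigraph sHG G3.
have [x bx xa] : exists2 x, edge H b x & edge H x a.
  have /connectP[p pp lp] := Hc b a bH aH.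
  move: gab; rewrite {}lp {aH hab}; case/shortenP: pp => {}p pp up _ gab.
  have := three_cyclic_size G3 (sub_path sE pp) gab up.
  by case: p pp {up gab} => [|x [|y []]] //= /and3P[bx xy _] _; exists x.
have /connectP[q] : connect (linked H x) a b.
  by apply: HL; apply/orP; [left|right].
case/shortenP=> {}q pq uq _ lb.
have asym y z : edge H y z -> edge H z y = false.
  by move=> yz; apply/negbTE/three_cyclic_asym.
(* The rim alternates between out- and in-neighbours of the hub. *)
have altern s y : path (linked H x) y s ->
    edge H x (last y s) = edge H x y (+) odd (size s).
  elim: s y => [|z s IHs] y /=; first by rewrite addbF.
  case/andP=> yz /IHs->; rewrite addbN -addNb; congr (_ (+) _).
  move: yz; rewrite /linked forms_tricycleE.
  by case/orP=> /and3P[h1 h2 h3]; rewrite ?h2 ?h3 asym.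
(* The path starts at the out-neighbour [a] of the hub and ends at its in-neighbour [b]. *)
have oq : odd (size q).
  by have := altern q a pq; rewrite -lb xa (asym _ _ bx) => /esym/negbFE.
(* Length one would make [a] and [b] adjacent in [H], but [a b] is not an edge of [H] and [b a]
   would form a 2-cycle with [a b] in [G]. *)
have q3 : 2 < size q.
  case: q oq pq lb {uq} => [|y [|z [|t q]]] //= _; rewrite andbT => + yb.
  rewrite -{}yb => /forms_tricycle_adj[/orP[ab|ba] _ _].
    by rewrite ab in hab.
  by have := three_cyclic_asym G3 gab; rewrite sE.
(* The rim is kept opaque so that [next c] does not unfold under simplification. *)
have [c def_c] : {c | c = a :: q} by exists (a :: q).
have tG : {in c, forall y, forms_tricycle G y (next c y) x}.
  move=> y; apply: (@next_cycle _ (linked G x) c).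
  rewrite def_c /= rcons_path -lb; apply/andP; split.
    by apply: sub_path pq => y1 y2; apply: forms_tricycle_subdigraph.
  by rewrite /linked forms_tricycleE gab (sE _ _ bx) (sE _ _ xa) orbT.
have xc y : y \in c -> adj G x y.
  by case/tG/forms_tricycle_adj.
have ac : a \in c by rewrite def_c mem_head.
have xNc : x \notin c by apply/negP=> /xc/adj_neq/eqP.
pose r := [rel y z | edge G y z && wheel_adj x c y z].
pose D := mk_digraph [set y in x :: c] r.
have wsym y z : wheel_adj x c y z = wheel_adj x c z y.
  rewrite /wheel_adj /= orbCA; congr [|| _, _ | _].
  by rewrite andbCA [(_ == _) || _]orbC.
have wc y z : wheel_adj x c y z -> y \in x :: c /\ adj G y z.
  have nadj y' : y' \in c -> adj G y' (next c y').
    by move=> /tG/forms_tricycle_adj[].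
  rewrite inE => /or3P[/andP[/eqP-> zc]|/andP[/eqP-> yc]|].
  - by rewrite eqxx; split=> //; apply: xc.
  - by rewrite yc orbT adj_sym; split=> //; apply: xc.
  - case/and3P=> yc zc; rewrite yc orbT => e; split=> //.
    by case/orP: e => /eqP->; [|rewrite adj_sym]; apply: nadj.
have ED y z : edge D y z = edge G y z && wheel_adj x c y z.
  rewrite edge_mk /r /=; apply/and4P/andP=> [[_ _ _ /andP[]]//|[gyz w]].
  have [yD _] := wc y z w; rewrite wsym in w; have [zD _] := wc z y w.
  by rewrite !inE in yD zD *; rewrite yD zD (edge_neq gyz) gyz wsym.
have nextw y : y \in c -> [/\ wheel_adj x c y (next c y),
    wheel_adj x c (next c y) x & wheel_adj x c x y].
  by move=> yc; rewrite /wheel_adj /= !mem_next yc !eqxx !orbT.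
apply: (Gfree D).
  apply: subdigraph_mk => [|y z _ _ /andP[]] //.
  apply/subsetP=> y; rewrite !inE => /predU1P[->|yc].
    by have [] := adj_vertices (xc a ac).
  by have [] := adj_vertices (xc y yc).
exists x, c; split; first by rewrite cons_uniq xNc def_c.
  (* The rim has one vertex more than the odd number [size q], which is at least three. *)
  by rewrite def_c /= !ltnS q3 oq.
split=> // [y z|y z|y yc].
- rewrite /adj /= !ED wsym -andb_orl andb_idl //.
  by move/wc=> [_]; rewrite adj_sym.
- by rewrite !ED; apply/negP=> /andP[/andP[yz _] /andP[zy _]];
     have := three_cyclic_asym G3 yz; rewrite zy.
- have := tG y yc; have [w1 w2 w3] := nextw y yc.
  move: (w1) (w2) (w3).
  rewrite wsym => w1'; rewrite wsym => w2'; rewrite wsym => w3'.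
  by rewrite !forms_tricycleE !ED w1 w2 w3 w1' w2' w3' !andbT.
Qed.

(** * Directed ears *)

(** The restricted relation tests only the target of an edge; as [z] lies outside [S], the whole
    path from [z] to [y] does. *)
Lemma last_exit (e : rel T) (S : {set T}) x y :
  connect e x y -> x \in S -> y \notin S ->
  exists a z, [/\ a \in S, z \notin S, e a z
    & connect [rel s t | e s t && (t \notin S)] z y].
Proof.
case/connectP=> p + -> xS {y}; elim/last_ind: p => [|p y IHp].
  by rewrite /= xS.
rewrite rcons_path last_rcons => /andP[xp py] yS.
have [pS|pS] := boolP (last x p \in S); first by exists (last x p), y.
have [a [z [aS zS az zp]]] := IHp xp pS.
exists a, z; split=> //; apply: connect_trans zp _.
by apply: connect1; rewrite /= py.
Qed.

Lemma first_entry (e : rel T) (S : {set T}) x y :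
  connect e x y -> x \notin S -> y \in S ->
  exists b z, [/\ b \in S, e z b
    & connect [rel s t | e s t && (t \notin S)] x z].
Proof.
case/connectP=> p + -> {y}; elim: p x => [|z p IHp] x /=.
  by move=> _ /negbTE->.
case/andP=> xz zp xS pS; have [zS|zS] := boolP (z \in S).
  by exists z, x.
have [b [t [bS tb zt]]] := IHp z zp zS pS.
exists b, t; split=> //; apply: connect_trans zt.
by apply: connect1; rewrite /= xz.
Qed.

(** [inn y a] and [out y b] say that a walk through the outside of [S] reaches [y] from [a],
    respectively [b] from [y]. If no ear has distinct ends, every outside vertex is entered from and
    left to one and the same vertex of [S]. That vertex is constant along outside edges, so it is a
    cutvertex. *)
Lemma exists_open_ear G (S : {set T}) :
  strongly_connected G -> {in vertices G, forall v, ~ cutvertex G v} ->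
  S \proper vertices G -> 1 < #|S| ->
  exists a b x q, [/\ a \in S, b \in S & a != b] /\
    [/\ edge G a x, path (edge G) x q, edge G (last x q) b, uniq (x :: q)
      & {in x :: q, forall y, y \notin S}].
Proof.
move=> Gs Gcut /properP[SG [y0 y0G y0S]] S2.
pose R := [rel s t | edge G s t && (t \notin S)].
pose inn y a :=
  (a \in S) && [exists x, [&& x \notin S, edge G a x & connect R x y]].
pose out y b := (b \in S) && [exists z, connect R y z && edge G z b].
have [/existsP[a /existsP[b /existsP[y]]]|/existsPn noear] :=
    boolP [exists a, exists b, exists y, [&& inn y a, out y b & a != b]].
  case/and3P=> /andP[aS /existsP[x /and3P[xS ax xy]]].
  case/andP=> bS /existsP[z /andP[yz zb]] ab.
  have /connectP[q] := connect_trans xy yz; case/shortenP=> {}q xq uq _ ez.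
  exists a, b, x, q; split=> //; split=> //.
  - by apply: sub_path xq => s t /andP[].
  - by rewrite -ez.
  move=> t; rewrite inE => /predU1P[->//|].
  elim: q x xq {ax xS xy uq ez} => //= s q IHq x /andP[/andP[_ sS] sq].
  by rewrite inE => /predU1P[->//|]; apply: IHq sq.
have same y a b : inn y a -> out y b -> a = b.
  move=> ya yb; apply/eqP; apply: contraT => ab; case/negP: (noear a).
  by apply/existsP; exists b; apply/existsP; exists y; rewrite ya yb.
have /card_gt0P[s0 s0S] := ltnW S2.
have ex_in y : y \in vertices G -> y \notin S -> exists a, inn y a.
  move=> yG yS; have s0y := Gs.2 s0 y (subsetP SG _ s0S) yG.
  have [a [z [aS zS az zy]]] := last_exit s0y s0S yS.
  by exists a; rewrite /inn aS; apply/existsP; exists z; rewrite zS az.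
have ex_out y : y \in vertices G -> y \notin S -> exists b, out y b.
  move=> yG yS; have ys0 := Gs.2 y s0 yG (subsetP SG _ s0S).
  have [b [z [bS zb yz]]] := first_entry ys0 yS s0S.
  by exists b; rewrite /out bS; apply/existsP; exists z; rewrite yz.
have [a0 ina0] := ex_in y0 y0G y0S.
have a0S : a0 \in S by case/andP: ina0.
have [s1 s1S s10] : exists2 s1, s1 \in S & s1 != a0.
  case/card_gt1P: S2 => s [t [sS tS st]].
  have [sa|sa] := eqVneq s a0; last by exists s.
  by exists t => //; rewrite -sa eq_sym.
have a0G := subsetP SG _ a0S; have s1G := subsetP SG _ s1S.
case: (Gcut a0 a0G); exists y0, s1; split.
- by rewrite !inE y0G andbT; apply: contraNneq y0S => ->.
- by rewrite !inE s10.
- exact: strongly_connected_adj.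
(* Everything reachable from y0 in G^- - a0 lies outside S and can be entered
   from S through a0 only. *)
apply/negP=> /connectP[p]; move: (y0S) (ina0).
elim: p {1 2 3 4}y0 => [|z p IHp] y /= yS ya; first by
  move=> _ e; rewrite -e s1S in yS.
case/andP=> /and3P[y_a0 z_a0 yz]; have [yG zG] := adj_vertices yz.
(* A neighbour of [y] in [S] is an entry or an exit of [y], hence [a0], which has been deleted. *)
have zS : z \notin S.
  apply/negP=> zS; case/orP: yz => [yz|zy].
    have yz' : out y z.
      by rewrite /out zS; apply/existsP; exists y; rewrite connect0.
    by rewrite (same _ _ _ ya yz') eqxx in z_a0.
  have zy' : inn y z.
    by rewrite /inn zS; apply/existsP; exists y; rewrite yS zy connect0.
  have [b yb] := ex_out y yG yS.
  by rewrite (same _ _ _ zy' yb) (same _ _ _ ya yb) eqxx in z_a0.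
(* The entry passes forward along [y z]; along [z y] it is the exit that passes back, and exits
   equal entries. *)
apply: IHp => //; case/orP: yz => [yz|zy].
  have /andP[aS /existsP[x /and3P[xS ax xy]]] := ya.
  rewrite /inn aS; apply/existsP; exists x; rewrite xS ax.
  by apply: connect_trans xy _; apply: connect1; rewrite /= yz.
have [b yb] := ex_out y yG yS; have [a za] := ex_in z zG zS.
have zb : out z b.
  have /andP[bS /existsP[x /andP[yx xb]]] := yb.
  rewrite /out bS; apply/existsP; exists x; rewrite xb andbT.
  by apply: connect_trans yx; apply: connect1; rewrite /= zy.
by rewrite (same _ _ _ ya yb) -(same _ _ _ za zb).
Qed.

(** * Enlarging a safely buildable subdigraph *)

Lemma digraph_eq G H :
  vertices G = vertices H -> edge G =2 edge H -> G = H.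
Proof.
case: G => [V E sE lE]; case: H => [V' E' sE' lE'] /= eV eE.
have eEE : E = E' by apply/setP=> -[x y]; apply: eE.
by subst V' E'; rewrite (bool_irrelevance sE sE') (bool_irrelevance lE lE').
Qed.

Lemma exists_tricycle G :
  strongly_connected G -> 1 < #|vertices G| -> three_cyclic G ->
  exists2 H, subdigraph H G & tricycle H.
Proof.
move=> [_ Gc] /card_gt1P[u [v [uG vG uv]]] G3.
have [x ux] : exists x, edge G u x.
  have /connectP[[|x p] /=] := Gc u v uG vG.
    by move=> _ e; rewrite e eqxx in uv.
  by case/andP; exists x.
have [_ xG] := edge_vertices ux.
have [z [xz zu]] := three_cyclic_arc G3 ux (Gc x u xG uG).
have [_ zG] := edge_vertices xz.
pose r := [rel s t | (s, t) \in [:: (u, x); (x, z); (z, u)]].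
have sub_r : subrel r (edge G).
  move=> s t; rewrite /= !inE !xpair_eqE.
  by case/or3P=> /andP[/eqP-> /eqP->].
exists (mk_digraph [set u; x; z] r).
  apply: subdigraph_mk => [|s t _ _]; last exact: sub_r.
  by apply/subsetP=> s; rewrite !inE -orbA => /or3P[]/eqP->.
exists u, x, z; split=> //.
  by rewrite /= !inE negb_or (edge_neq ux) (edge_neq xz) eq_sym (edge_neq zu).
apply/setP=> -[s t]; rewrite !inE /= !inE -!orbA !andbA andb_idl //.
move=> st; have := sub_r s t; rewrite /= !inE => /(_ st)/edge_neq->.
move: st; rewrite !xpair_eqE.
by case/or3P=> /andP[/eqP-> /eqP->]; rewrite !eqxx ?orbT.
Qed.

Lemma safely_buildable_enlarge G H :
  unbreakable G -> three_cyclic G -> diwheel_free G ->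
  safely_buildable H -> subdigraph H G -> H <> G ->
  exists H', [/\ safely_buildable H', subdigraph H' G
               & vertices H \proper vertices H'].
Proof.
move=> [Gs [_ _ Gcut]] G3 Gfree sbH sHG HG.
have sE := edge_subdigraph sHG.
have Hs := safely_buildable_strongly_connected sbH.
have HL := safely_buildable_links_connected sbH.
(* By [chord_diwheel], [H] is induced in [G]; being different from [G], it therefore misses a
   vertex. *)
have EH : {in vertices H &, forall x y, edge H x y = edge G x y}.
  move=> x y xH yH; apply/idP/idP=> [/sE//|xy]; apply: contraT => nxy.
  by case: (chord_diwheel G3 sHG Hs HL xH yH xy nxy).
have VH : vertices H \proper vertices G.
  rewrite properEneq sHG.1 andbT; apply/eqP=> VHG; apply: HG.
  apply: digraph_eq => // x y; apply/idP/idP=> [/sE//|xy].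
  by have [xG yG] := edge_vertices xy; rewrite EH // VHG.
have H2 : 1 < #|vertices H|.
  by have [_ [H2 _ _]] := safely_buildable_unbreakable sbH; apply: ltnW.
have [a [b [w [q [[aH bH ab] [aw wq qb uq qH]]]]]] :=
  exists_open_ear Gs Gcut VH H2.
(* The ear followed by a path of [H] from [b] to [a] is a directed cycle, so it has exactly two
   vertices besides [w]. *)
have cyc p : path (edge H) b p -> last b p = a -> uniq (b :: p) ->
    size (q ++ b :: p) = 2.
  move=> bp pa up; apply: (three_cyclic_size (x := w) G3).
  - by rewrite cat_path wq /= qb (sub_path sE).
  - by rewrite last_cat /= pa.
  - rewrite -cat_cons cat_uniq uq up andbT; apply/hasPn=> y yp.
    apply/negP=> /qH/negP; apply; move: yp; rewrite inE => /predU1P[->//|].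
    elim: p b bp {aH bH ab pa up qb} => //= z p IHp b /andP[bz zp].
    rewrite inE => /predU1P[->|]; last exact: IHp zp.
    by have [] := edge_vertices bz.
have /connectP[p] := Hs.2 b a bH aH.
case/shortenP=> {}p bp up _ pa.
have := cyc p bp (esym pa) up; rewrite size_cat.
(* As [a != b], the return path is nonempty. This leaves no room for [q]: the ear is [a -> w -> b]
   and the return path is the edge [b a]. *)
case: p bp up pa => [|y p] bp up pa /=; first by rewrite pa eqxx in ab.
rewrite !addnS => -[] /eqP; rewrite addn_eq0 => /andP[q0 /nilP p0].
move/nilP: q0 => q0; subst p q; rewrite /= in bp pa qb; subst y.
have {bp} ba : edge H b a by case/andP: bp.
have wH : w \notin vertices H by apply: qH; rewrite mem_head.
have [H' [att VH' EH']] := exists_attached_ear ba wH.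
exists H'; split.
- apply: safely_buildable_attach_ear sbH ba _ att => p bp pa up'.
  by have := cyc p bp pa up' => -[].
- apply: subdigraph_subrel => [|x y /EH'[/sE //|[-> ->] //|[-> ->] //]].
  rewrite VH' subUset sHG.1 sub1set andbT.
  by have [] := edge_vertices aw.
- by rewrite VH' properUr // sub1set.
Qed.

(** Maximality is replaced by induction on the number of vertices of [G] missing from [H], starting
    from any tricycle of [G]. *)
Lemma unbreakable_safely_buildable G :
  unbreakable G -> three_cyclic G -> diwheel_free G -> safely_buildable G.
Proof.
move=> Gu G3 Gfree; have [Gs [/ltnW G2 _ _]] := Gu.
have [H sHG /safely_buildable_tricycle sbH] := exists_tricycle Gs G2 G3.
have [n] := ubnP (#|vertices G| - #|vertices H|).
elim: n H sHG sbH => // n IHn H sHG sbH ltn.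
have [/andP[/eqP eV /eqP eE]|neVE] :=
    boolP ((vertices H == vertices G) && (edges H == edges G)).
  by rewrite -(@digraph_eq H G eV) // => x y; rewrite /edge /= eE.
have ngh : H <> G by move=> eHG; rewrite eHG !eqxx in neVE.
have [H' [sbH' sH'G HH']] := safely_buildable_enlarge Gu G3 Gfree sbH sHG ngh.
apply: (IHn H') => //; apply: (leq_trans _ (ltn : _ <= n)).
have ltHH' := proper_card HH'; apply: ltn_sub2l => //.
exact: leq_trans ltHH' (subset_leq_card sH'G.1).
Qed.
End Digraphs.

Theorem mainTheorem3 (T : finType) (G : digraph T) :
  (unbreakable G /\ three_cyclic G /\ diwheel_free G) <-> safely_buildable G.
Proof.
split=> [[Gu [G3 Gfree]]|sbG]; first exact: unbreakable_safely_buildable.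
split; first exact: safely_buildable_unbreakable.
by split; [apply: safely_buildable_three_cyclic
          |apply: safely_buildable_diwheel_free].
Qed.
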